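(* Let $\gamma\ge 2$, $B(x)=x^\gamma$ and $b(y,x)=2y^{\gamma-1}$, and define the self-similar fragmentation operator $$\mathcal L u:=-(xu)'-u+\gamma\,\mathcal F u,\qquad \mathcal F u(x):=\int_x^\infty b(y,x)u(y)\,dy-B(x)u(x)=2\int_x^\infty y^{\gamma-1}u(y)\,dy-x^\gamma u(x).$$ Let $\Xi:=L^1((0,\infty),x^{1+\gamma}\,dx)\cap W^{1,1}((0,\infty),x\,dx)$ and $\Xi_0:=\{u\in\Xi:\ \int_0^\infty x\,u(x)\,dx=0\}$, and let $(u,v):=\int_0^\infty x\,u(x)v(x)\,dx$. Then $$\forall u\in\Xi_0,\qquad (u,\mathcal L u)\le -\int_0^\infty x\,u(x)^2\,dx=-\|u\|^2_{L^2(x\,dx)}.$$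
   Context: All functions are real-valued on $(0,\infty)$. $W^{1,1}((0,\infty),x\,dx)$ is the space of functions $u\in L^1((0,\infty),x\,dx)$ whose weak derivative $u'$ also belongs to $L^1((0,\infty),x\,dx)$. The derivative $(xu)'$ is the weak derivative of $x\mapsto xu(x)$. *)

(* Defs.v *)
From HB Require Import structures.
From mathcomp Require Import all_boot all_order all_algebra.
From mathcomp Require Import all_classical all_reals all_analysis.

Set Implicit Arguments.
Unset Strict Implicit.
Unset Printing Implicit Defensive.

Import Order.TTheory GRing.Theory Num.Theory.
Import numFieldNormedType.Exports.

Local Open Scope classical_set_scope.
Local Open Scope ring_scope.

(* Functions on (0, +oo) are represented by total functions R -> R; only
   their restrictions to [halfline] are ever used. *)
Definition halfline (R : realType) : set R := `]0, +oo[.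
Arguments halfline : clear implicits.

Definition test_function (R : realType) (phi : R -> R) : Prop :=
  [/\ forall n x, derivable (derive1n n phi) x 1,
      compact (closure [set x | phi x != 0]) &
      closure [set x | phi x != 0] `<=` halfline R].

(* [v] is a representative of the weak derivative of [u] on (0, +oo). *)
Definition weak_derivative (R : realType) (u v : R -> R) : Prop :=
  [/\ locally_integrable (halfline R) u,
      locally_integrable (halfline R) v &
      forall phi : R -> R, test_function phi ->
        Rintegral lebesgue_measure (halfline R) (fun x => u x * derive1 phi x) =
        - Rintegral lebesgue_measure (halfline R) (fun x => v x * phi x)].

(* A chosen representative of the weak derivative; meaningful only when [u]
   has a weak derivative, and then unique up to a.e. equality. *)
Definition wderiv (R : realType) (u : R -> R) : R -> R :=
  xget (fun=> 0) [set v | weak_derivative u v].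

(* L^1((0, +oo), w(x) dx) *)
Definition weighted_L1 (R : realType) (w u : R -> R) : Prop :=
  measurable_fun (halfline R) u /\
  lebesgue_measure.-integrable (halfline R) (fun x => (w x * u x)%:E).

(* W^{1,1}((0, +oo), w(x) dx) *)
Definition weighted_W11 (R : realType) (w u : R -> R) : Prop :=
  weighted_L1 w u /\ exists2 v, weak_derivative u v & weighted_L1 w v.

Definition Xi (R : realType) (gamma : R) : set (R -> R) :=
  [set u | weighted_L1 (fun x => x `^ (1 + gamma)) u /\ weighted_W11 id u].

Definition Xi0 (R : realType) (gamma : R) : set (R -> R) :=
  [set u | Xi gamma u /\
           Rintegral lebesgue_measure (halfline R) (fun x => x * u x) = 0].

Definition inner (R : realType) (u v : R -> R) : R :=
  Rintegral lebesgue_measure (halfline R) (fun x => x * u x * v x).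

Definition normL2 (R : realType) (u : R -> R) : R :=
  Num.sqrt (Rintegral lebesgue_measure (halfline R) (fun x => x * u x ^+ 2)).

Definition frag (R : realType) (b : R -> R -> R) (B u : R -> R) (x : R) : R :=
  Rintegral lebesgue_measure `]x, +oo[ (fun y => b y x * u y) - B x * u x.

Definition total_rate (R : realType) (gamma x : R) : R := x `^ gamma.

Definition frag_kernel (R : realType) (gamma y x : R) : R :=
  2 * y `^ (gamma - 1).

Definition selfsim_frag (R : realType) (gamma : R) (u : R -> R) (x : R) : R :=
  - wderiv (fun y => y * u y) x - u x
  + gamma * frag (frag_kernel gamma) (total_rate gamma) u x.

(* Main.v *)
Require Import Defs.
From mathcomp Require Import all_boot all_order all_algebra.
From mathcomp Require Import all_classical all_reals all_analysis.
From mathcomp Require Import measurable_realfun ring lra.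
Import Order.TTheory GRing.Theory Num.Theory.
Import numFieldNormedType.Exports.
Local Open Scope classical_set_scope.
Local Open Scope ring_scope.

(* Let [g = u'] be the weak derivative.  Testing against smooth functions shows
   that [u(x) = - int_x^oo g] almost everywhere, so that [x u] is bounded and [u]
   is integrable; with [v = (x u)'] one also has [x u(x) = - int_x^oo v] and
   [int v = 0].  Every estimate then comes from Fubini's theorem on [x < y], in
   the form [int F(x) int_x^oo F = (int F)^2 / 2].
   With [F = v] this gives [int x u (x u)' = 0], so that the transport part of the
   operator contributes exactly [- int x u^2].
   For the gain term put [f = x u], which has zero mean, and [h(y) = y^(gamma-2)],
   which is nonnegative and nondecreasing as [gamma >= 2].  Then
   [int f(x) int_x^oo f h = - int h(y) f(y) int_y^oo f], and writing [h] as a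
   superposition of the indicators of [{h > s}] turns this into minus an average
   of the squares [(int_{h > s} f)^2 / 2].  The loss term has a sign. *)

(** * Real-valued integrals and almost everywhere equality *)

Section integrals.
Context {d : measure_display} {T : measurableType d} {R : realType}.
Variable mu : {measure set T -> \bar R}.
Notation L1 f := (mu.-integrable setT (EFin \o f)).
Implicit Types f g : T -> R.

Lemma ae_imply (P Q : T -> Prop) : (forall x, P x -> Q x) ->
  {ae mu, forall x, P x} -> {ae mu, forall x, Q x}.
Proof. by move=> PQ; apply: filterS => //; exact: (ae_filter_ringOfSetsType mu). Qed.

Lemma ae_imply2 (P Q S : T -> Prop) : (forall x, P x -> Q x -> S x) ->
  {ae mu, forall x, P x} -> {ae mu, forall x, Q x} -> {ae mu, forall x, S x}.
Proof. by move=> PQ; apply: filterS2 => //; exact: (ae_filter_ringOfSetsType mu). Qed.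

Lemma integrable_le f g : measurable_fun setT f -> L1 g ->
  (forall x, `|f x| <= `|g x|) -> L1 f.
Proof.
move=> mf ig fg; apply: le_integrable ig => //; first exact/measurable_EFinP.
by move=> x _; rewrite /= lee_fin.
Qed.

Lemma integrable_measurable f : L1 f -> measurable_fun setT f.
Proof. by move=> /measurable_int /measurable_EFinP. Qed.

Lemma integrable_bounded_mul (c : R) f g : measurable_fun setT f -> L1 g ->
  (forall x, `|f x| <= c) -> L1 (fun x => f x * g x).
Proof.
move=> mf ig fc; have := integrableZl measurableT c ig.
apply: le_integrable => //.
  apply/measurable_EFinP; apply: measurable_funM => //.
  exact: integrable_measurable.
move=> x _ /=; rewrite lee_fin !normrM ler_wpM2r//.
by rewrite (le_trans (fc x))// ler_norm.
Qed.

(** The extended integral of such a function is infinite, and [fine] sends both infinities to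
    [0]. *)
Lemma not_integrable_Rintegral f : measurable_fun setT f -> ~ L1 f ->
  \int[mu]_x f x = 0.
Proof.
move=> mf nf; rewrite /Rintegral.
have : ~~ ((\int[mu]_x (f x)%:E)%E \is a fin_num).
  apply/negP => fin; apply: nf; apply/integrableP.
  split; first exact/measurable_EFinP.
  by have := integral_fin_num_abs mu measurableT mf; rewrite fin /= => ->.
by rewrite fin_numE negb_and !negbK => /orP[] /eqP ->.
Qed.

(* No integrability is needed: a divergent integral is read as [0]. *)
Lemma measurable_RintegralZl (c : R) f : measurable_fun setT f ->
  \int[mu]_x (c * f x) = c * \int[mu]_x f x.
Proof.
move=> mf; have [->|c0] := eqVneq c 0.
  by rewrite mul0r; under eq_Rintegral do rewrite mul0r; rewrite Rintegral_cst// mul0r.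
have [i|ni] := pselect (L1 f); first exact: RintegralZl.
rewrite (not_integrable_Rintegral f mf ni) mulr0 not_integrable_Rintegral//.
  exact: measurable_funM.
move=> i; apply: ni; have := integrableZl measurableT c^-1 i.
by apply: eq_integrable => // x _; rewrite /= -EFinM mulrA mulVf// mul1r.
Qed.

Lemma ae_eq_Rintegral f g : measurable_fun setT f -> measurable_fun setT g ->
  {ae mu, forall x, f x = g x} -> \int[mu]_x f x = \int[mu]_x g x.
Proof.
move=> mf mg fg; congr fine; apply: ae_eq_integral => //.
- exact/measurable_EFinP.
- exact/measurable_EFinP.
- by apply: ae_imply fg => x fgx _ /=; rewrite fgx.
Qed.

Lemma ae_eq_integrable f g : measurable_fun setT g ->
  {ae mu, forall x, f x = g x} -> L1 f -> L1 g.
Proof.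
move=> mg fg /integrableP[mf fi]; apply/integrableP; split; first exact/measurable_EFinP.
rewrite -(@ae_eq_integral _ _ _ mu setT _ (abse \o (EFin \o f))) //.
- exact: measurableT_comp.
- by apply: measurableT_comp => //; exact/measurable_EFinP.
- by apply: ae_imply fg => x fgx _ /=; rewrite fgx.
Qed.

Lemma integrable_fine (H : T -> \bar R) : mu.-integrable setT H -> L1 (fine \o H).
Proof.
move=> iH; apply: (le_integrable measurableT _ _ iH).
  by apply/measurable_EFinP; apply: measurableT_comp => //; exact: measurable_int iH.
by move=> x _ /=; case: (H x) => [r| |] //=; rewrite ?leey ?abse0 ?normr0.
Qed.

(** An integrable extended-valued function is finite almost everywhere, so [fine] alters it only on
    a null set. *)
Lemma integral_fine (H : T -> \bar R) : mu.-integrable setT H ->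
  (\int[mu]_x (fine (H x))%:E = \int[mu]_x H x)%E.
Proof.
move=> iH; apply: ae_eq_integral => //.
- exact: measurable_int (integrable_fine _ iH).
- exact: measurable_int iH.
- by apply: ae_imply (integrable_ae measurableT iH) => x hx Dx; rewrite fineK// hx.
Qed.

End integrals.

(** * Fubini's theorem for integral kernels *)

Section fubini_kernel.
Context {d1 d2 : measure_display} {T1 : measurableType d1} {T2 : measurableType d2}.
Context {R : realType}.
Variables (m1 : {sigma_finite_measure set T1 -> \bar R}).
Variables (m2 : {sigma_finite_measure set T2 -> \bar R}).

(** The bound [c] on the sections makes the integrand integrable on the product by Tonelli, after
    which Fubini applies. This form covers functions [p] such as the indicator of a half-line,
    integrable only against the kernel. *)
Lemma fubini_kernel (k : T1 * T2 -> R) (p : T1 -> R) (q c : T2 -> R) :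
  measurable_fun setT k -> measurable_fun setT p -> measurable_fun setT q ->
  (forall y, q y != 0 -> (\int[m1]_x `|k (x, y) * p x|%:E <= (c y)%:E)%E) ->
  m2.-integrable setT (EFin \o (fun y => q y * c y)) ->
  [/\ m1.-integrable setT (EFin \o (fun x => p x * \int[m2]_y (k (x, y) * q y))),
      m2.-integrable setT (EFin \o (fun y => q y * \int[m1]_x (k (x, y) * p x))) &
      \int[m1]_x (p x * \int[m2]_y (k (x, y) * q y)) =
      \int[m2]_y (q y * \int[m1]_x (k (x, y) * p x))].
Proof.
move=> mk mp mq kc qc.
pose F (z : T1 * T2) := p z.1 * (k z * q z.2).
have mF : measurable_fun setT F.
  apply: measurable_funM; first exact: measurableT_comp mp measurable_fst.
  by apply: measurable_funM => //; exact: measurableT_comp mq measurable_snd.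
have mEF : measurable_fun setT (EFin \o F) by exact/measurable_EFinP.
have mky y : measurable_fun setT (fun x => k (x, y)).
  by apply: measurableT_comp mk _; exact: measurable_pair2.
have mkx x : measurable_fun setT (fun y => k (x, y)).
  by apply: measurableT_comp mk _; exact: measurable_pair1.
have iF : (m1 \x m2)%E.-integrable setT (EFin \o F).
  apply/integrable21ltyP => //.
  move/integrableP : qc => [mqc]; apply: le_lt_trans.
  apply: ge0_le_integral => //.
  - by move=> y _; exact: integral_ge0.
  - have := @measurable_fun_fubini_tonelli_G _ _ _ _ _ m1 (abse \o (EFin \o F)).
    by apply=> [|z]; [exact: measurableT_comp|exact: abse_ge0].
  - exact: measurableT_comp.
  move=> y _ /=.
  (* Where [q] vanishes the whole section does, whatever the kernel. *)
  have [q0|q0] := eqVneq (q y) 0.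
    rewrite q0 mul0r normr0 (_ : (fun x => _) = cst 0%E) ?integral0//.
    by apply/funext => x /=; rewrite /F /= q0 !mulr0 normr0.
  have -> : (\int[m1]_x `|(F (x, y))%:E| = `|q y|%:E * \int[m1]_x `|k (x, y) * p x|%:E)%E.
    rewrite -ge0_integralZl//; last first.
      by apply/measurable_EFinP; apply: measurableT_comp => //; exact: measurable_funM.
    by apply: eq_integral => x _ /=; rewrite -EFinM -normrM /F /=; congr (`|_|%:E); ring.
  rewrite normrM EFinM lee_wpmul2l ?lee_fin//.
  by rewrite (le_trans (kc _ q0))// lee_fin ler_norm.
(* Constants come out of divergent integrals as well, both sides being then [0]; so these identities
   hold at every point and not only almost everywhere. *)
have h1 x : p x * \int[m2]_y (k (x, y) * q y) = fine (fubini_F m2 (EFin \o F) x).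
  by rewrite -measurable_RintegralZl//; exact: measurable_funM.
have h2 y : q y * \int[m1]_x (k (x, y) * p x) = fine (fubini_G m1 (EFin \o F) y).
  rewrite -measurable_RintegralZl//; last exact: measurable_funM.
  by congr fine; apply: eq_integral => x _ /=; rewrite /F /=; congr (_%:E); ring.
have i1 := integrable_fubini_F iF.
(* The inner integral is bounded by that of the absolute value, whose iterated integral is
   finite. *)
have i2 : m2.-integrable setT (fubini_G m1 (EFin \o F)).
  apply/integrableP; split; first exact: (measurable_fubini_G iF).
  have := (integrable21ltyP _ _ mEF).1 iF; apply: le_lt_trans.
  apply: ge0_le_integral => //.
  - by apply: measurableT_comp => //; exact: (measurable_fubini_G iF).
  - have := @measurable_fun_fubini_tonelli_G _ _ _ _ _ m1 (abse \o (EFin \o F)).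
    by apply=> [|z]; [exact: measurableT_comp|exact: abse_ge0].
  - move=> y _; apply: le_abse_integral => //.
    by apply: measurableT_comp mEF _; exact: measurable_pair2.
split.
- by apply: eq_integrable (integrable_fine _ _ i1) => // x _ /=; rewrite h1.
- by apply: eq_integrable (integrable_fine _ _ i2) => // x _ /=; rewrite h2.
- rewrite /Rintegral; congr fine.
  transitivity (\int[m1]_x fubini_F m2 (EFin \o F) x)%E.
    by rewrite -(integral_fine _ _ i1); apply: eq_integral => x _; rewrite -h1.
  transitivity (\int[m2]_x fubini_G m1 (EFin \o F) x)%E; last first.
    by rewrite -(integral_fine _ _ i2); apply: eq_integral => x _; rewrite -h2.
  exact: Fubini iF.
Qed.

(** Tonelli's theorem makes the integrals of the positive and negative parts measurable in [x];
    their difference and [fine] preserve this. *)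
Lemma measurable_Rintegral2 (k : T1 * T2 -> R) : measurable_fun setT k ->
  measurable_fun setT (fun x => \int[m2]_y k (x, y)).
Proof.
move=> mk; apply: (@measurableT_comp _ _ _ _ _ _ fine) => //.
have mEk : measurable_fun setT (EFin \o k) by exact/measurable_EFinP.
have -> : (fun x => (\int[m2]_y (k (x, y))%:E)%E) =
    ((fun x => \int[m2]_y (EFin \o k)^\+ (x, y)) \-
     (fun x => \int[m2]_y (EFin \o k)^\- (x, y)))%E.
  apply/funext => x; rewrite integralE.
  by congr (_ - _)%E; apply: eq_integral => y _; rewrite ?funeposE ?funenegE.
apply: emeasurable_funB.
- apply: (@measurable_fun_fubini_tonelli_F _ _ _ _ _ m2 ((EFin \o k)^\+)%E) => //.
  exact: measurable_funepos.
- apply: (@measurable_fun_fubini_tonelli_F _ _ _ _ _ m2 ((EFin \o k)^\-)%E) => //.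
  exact: measurable_funeneg.
Qed.

End fubini_kernel.

(** * Tail integrals and Fubini on the triangle [x < y] *)

Section tails.
Context {R : realType}.
Notation mu := (@lebesgue_measure R).
Notation L1 f := (mu.-integrable setT (EFin \o f)).
Implicit Types (f g p q c : R -> R) (x y : R).

(** Written with an indicator over the whole line, so that it is a kernel integral in the sense of
    [fubini_kernel]. *)
Definition tail f x : R := \int[mu]_y ((x < y)%R%:R * f y).

Lemma measurable_bool_natr d (T : measurableType d) (b : T -> bool) :
  measurable_fun setT b -> measurable_fun setT (fun t => (b t)%:R : R).
Proof.
move=> mb; rewrite (_ : (fun t => _) = \1_(b @^-1` [set true])).
  by apply: measurable_indic; rewrite -[X in measurable X]setTI; exact: mb.
apply/funext => t; rewrite indicE; congr (nat_of_bool _)%:R.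
by apply/idP/idP; rewrite inE.
Qed.

Lemma measurable_lt_indic : measurable_fun setT (fun z : R * R => (z.1 < z.2)%R%:R : R).
Proof. by apply: measurable_bool_natr; exact: measurable_fun_ltr. Qed.

Lemma measurable_gt_indic x : measurable_fun setT (fun y => (x < y)%R%:R : R).
Proof. by apply: measurable_bool_natr; exact: measurable_fun_ltr. Qed.

Lemma measurable_below_indic y : measurable_fun setT (fun x => (x < y)%R%:R : R).
Proof. by apply: measurable_bool_natr; exact: measurable_fun_ltr. Qed.

Lemma measurable_tail f : measurable_fun setT f -> measurable_fun setT (tail f).
Proof.
move=> mf; apply: (measurable_Rintegral2 mu (fun z : R * R => (z.1 < z.2)%R%:R * f z.2)).
apply: measurable_funM; first exact: measurable_lt_indic.
exact: measurableT_comp mf measurable_snd.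
Qed.

Lemma norm_bool_natr (b : bool) : `|b%:R : R| <= 1.
Proof. by case: b; rewrite ?normr1 ?normr0. Qed.

Lemma integrable_gt_indic f x : L1 f -> L1 (fun y => (x < y)%R%:R * f y).
Proof.
move=> i; apply: (integrable_bounded_mul mu 1) => //; first exact: measurable_gt_indic.
by move=> y; exact: norm_bool_natr.
Qed.

Lemma fubini_triangle p q c :
  measurable_fun setT p -> measurable_fun setT q ->
  (forall y, q y != 0 -> (\int[mu]_x `|(x < y)%R%:R * p x|%:E <= (c y)%:E)%E) ->
  L1 (fun y => q y * c y) ->
  [/\ L1 (fun x => p x * tail q x),
      L1 (fun y => q y * \int[mu]_x ((x < y)%R%:R * p x)) &
      \int[mu]_x (p x * tail q x) =
      \int[mu]_y (q y * \int[mu]_x ((x < y)%R%:R * p x))].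
Proof. by move=> mp mq; exact: (fubini_kernel mu mu _ _ _ c measurable_lt_indic). Qed.

Lemma integral_norm_fin f : L1 f ->
  (\int[mu]_x `|f x|%:E = (\int[mu]_x `|f x|)%:E)%E.
Proof.
move=> /integrable_norm i; rewrite /Rintegral fineK//.
exact: integrable_fin_num i.
Qed.

Lemma le_integral_norm f g : measurable_fun setT f -> L1 g -> (forall x, `|f x| <= `|g x|) ->
  (\int[mu]_x `|f x|%:E <= (\int[mu]_x `|g x|)%:E)%E.
Proof.
move=> mf ig fg; rewrite -integral_norm_fin//; apply: ge0_le_integral => //.
- by apply/measurable_EFinP; exact: measurableT_comp.
- by apply/measurable_EFinP; apply: measurableT_comp => //; exact: integrable_measurable ig.
- by move=> x _; rewrite lee_fin.
Qed.

Lemma fubini_triangle_L1 p q : L1 p -> L1 q ->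
  [/\ L1 (fun x => p x * tail q x),
      L1 (fun y => q y * \int[mu]_x ((x < y)%R%:R * p x)) &
      \int[mu]_x (p x * tail q x) =
      \int[mu]_y (q y * \int[mu]_x ((x < y)%R%:R * p x))].
Proof.
move=> ip iq.
have mp := integrable_measurable mu _ ip; have mq := integrable_measurable mu _ iq.
(* The kernel is at most [1], so the norm of [p] bounds every section. *)
apply: (fubini_triangle p q (fun=> \int[mu]_x `|p x|)) => //.
- move=> y _; apply: le_integral_norm => //.
    by apply: measurable_funM => //; exact: measurable_below_indic.
  by move=> x; rewrite normrM ler_piMl ?norm_bool_natr.
- by apply: eq_integrable (integrableZr measurableT (\int[mu]_x `|p x|) iq).
Qed.

(** The two strict inequalities miss only the point [y], which is a null set. *)
Lemma tail_compl f y : L1 f ->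
  \int[mu]_x ((x < y)%R%:R * f x) = \int[mu]_x f x - tail f y.
Proof.
move=> i; rewrite /tail -RintegralB//; last exact: integrable_gt_indic.
have mf := integrable_measurable mu _ i.
apply: (ae_eq_Rintegral mu).
- by apply: measurable_funM => //; exact: measurable_below_indic.
- by apply: measurable_funB => //; apply: measurable_funM => //; exact: measurable_gt_indic.
- exists [set y]; split => //.
    exact: lebesgue_measure_set1.
  move=> x /=; apply: contra_notP => /eqP xy.
  have [xy'|xy'|/eqP] := ltgtP x y; rewrite ?mul1r ?mul0r ?subr0 ?subrr//.
  by rewrite (negbTE xy).
Qed.

(* Splits the plane along its diagonal. *)
Lemma integral_mul_tail f : L1 f ->
  L1 (fun x => f x * tail f x) /\
  2 * \int[mu]_x (f x * tail f x) = (\int[mu]_x f x) ^+ 2.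
Proof.
move=> i; have [i1 i2 e] := fubini_triangle_L1 f f i i; split => //.
rewrite mulr_natl mulr2n {1}e -RintegralD//.
under eq_Rintegral do rewrite tail_compl// -mulrDr subrK.
by rewrite RintegralZr.
Qed.

End tails.

(** * Layer-cake formula and the sign of a weighted tail form *)

Section layer_cake.
Context {R : realType}.
Notation mu := (@lebesgue_measure R).
Notation L1 f := (mu.-integrable setT (EFin \o f)).
Implicit Types (f g p q c : R -> R) (x y : R).

(** This is the length of []x, z[], with a factor for the empty case. It evaluates the inner
    integrals of the later uses of Fubini, and is extended-valued to fit the bound required
    there. *)
Lemma integral_itv_indic x z : (\int[mu]_t ((t < z)%R%:R * (x < t)%R%:R : R)%:E =
  ((x < z)%R%:R * (z - x))%:E)%E.
Proof.
rewrite (_ : (fun t => _) = (fun t => (\1_`]x, z[%classic t)%:E)); last first.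
  apply/funext => t; rewrite indicE mem_setE in_itv/=.
  by case: (t < z); case: (x < t); rewrite ?mul0r ?mul1r.
rewrite integral_indic// setIT.
transitivity (lebesgue_measure `]x, z[%classic) => //.
rewrite lebesgue_measure_itv/= lte_fin.
by case: ltP; rewrite ?mul0r ?mul1r// EFinB.
Qed.

Lemma norm_tail_le f x : L1 f -> `|tail f x| <= \int[mu]_y `|f y|.
Proof.
move=> i; have ix := integrable_gt_indic f x i.
apply: (le_trans (le_normr_Rintegral measurableT ix)).
apply: le_Rintegral => //; first exact: integrable_norm ix.
  exact: integrable_norm i.
by move=> y _; rewrite normrM ler_piMl ?norm_bool_natr.
Qed.

(* By the layer-cake formula [h] is a superposition of indicators of upper sets, on
   each of which the kernel integrates to minus half a square. *)
Lemma integral_mul_tail_le0 f (h : R -> R) : L1 f -> \int[mu]_x f x = 0 ->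
  measurable_fun setT h -> (forall x, 0 <= h x) -> {homo h : x y / x <= y} ->
  L1 (fun x => f x * h x) ->
  L1 (fun x => f x * tail (fun y => f y * h y) x) /\
  \int[mu]_x (f x * tail (fun y => f y * h y) x) <= 0.
Proof.
move=> i f0 mh h0 homoh ih.
have mf := integrable_measurable mu _ i.
have mt := measurable_tail _ mf.
have [i1 i2 e] := fubini_triangle_L1 _ _ i ih; split => //; rewrite {}e.
pose q y := f y * tail f y.
(* The tail of [f] is bounded by the norm of [f], so the product stays integrable. *)
have iq : L1 (fun y => q y * h y).
  have := integrable_bounded_mul mu _ _ _ mt ih (norm_tail_le f ^~ i).
  by apply: eq_integrable => // y _ /=; congr (_%:E); rewrite /q; ring.
(* As [f] has mean zero, its integral below [y] is minus its tail at [y]. *)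
have -> : \int[mu]_y (f y * h y * \int[mu]_x ((x < y)%R%:R * f x)) =
    - \int[mu]_y (q y * h y).
  rewrite -mulN1r -RintegralZl//; apply: eq_Rintegral => y _.
  by rewrite tail_compl// f0 /q; ring.
rewrite oppr_le0.
have mk : measurable_fun setT (fun z : R * R => (z.1 < h z.2)%R%:R : R).
  apply: measurable_bool_natr; apply: measurable_fun_ltr => //.
  exact: measurableT_comp mh measurable_snd.
(* [h y] is the length of the interval of levels []0, h y[], empty when [h y = 0]. *)
have hcake y : (\int[mu]_s `|(s < h y)%R%:R * (0 < s)%R%:R|%:E = (h y)%:E)%E.
  transitivity (\int[mu]_s ((s < h y)%R%:R * (0 < s)%R%:R : R)%:E)%E.
    by apply: eq_integral => s _; rewrite ger0_norm.
  rewrite integral_itv_indic subr0; have := h0 y; rewrite le_eqVlt => /predU1P[<-|->].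
    by rewrite mulr0.
  by rewrite mul1r.
have hcake_le y : q y != 0 ->
    (\int[mu]_s `|(s < h y)%R%:R * (0 < s)%R%:R|%:E <= (h y)%:E)%E.
  by rewrite hcake.
have [_ _] := fubini_kernel mu mu (fun z : R * R => (z.1 < h z.2)%R%:R)
  (fun s => (0 < s)%R%:R) q h mk (measurable_gt_indic 0)
  (measurable_funM mf mt) hcake_le iq.
have -> : \int[mu]_y (q y * \int[mu]_x ((x < h y)%R%:R * (0 < x)%R%:R)) =
    \int[mu]_y (q y * h y).
  apply: eq_Rintegral => y _; congr (_ * _).
  rewrite -[RHS]/(fine (h y)%:E) -hcake; congr fine.
  by apply: eq_integral => s _; rewrite ger0_norm.
move=> <-; apply: Rintegral_ge0 => s _; apply: mulr_ge0 => //.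
pose F y := (s < h y)%R%:R * f y.
have mFk : measurable_fun setT (fun y => (s < h y)%R%:R : R).
  by apply: measurable_bool_natr; exact: measurable_fun_ltr.
have iF : L1 F.
  apply: (integrable_bounded_mul mu 1) => //.
  by move=> y; exact: norm_bool_natr.
have [_ e] := integral_mul_tail F iF.
(* The set [{h > s}] is upward closed: once it contains [y] it contains every [z > y], so
   restricting the tail to it changes nothing. *)
suff -> : \int[mu]_y ((s < h y)%R%:R * q y) = \int[mu]_y (F y * tail F y).
  by rewrite -(@pmulr_rge0 _ 2)// e sqr_ge0.
apply: eq_Rintegral => y _; rewrite /F /q; case: ltP => shy; rewrite ?mul0r// !mul1r.
congr (_ * _); apply: eq_Rintegral => z _ /=.
by case: ltP => yz; rewrite ?mul0r// !mul1r (lt_le_trans shy) ?mul1r// homoh// ltW.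
Qed.

End layer_cake.

(** * The primitive vanishing at infinity *)

Section decaying_primitive.
Context {R : realType}.
Notation mu := (@lebesgue_measure R).
Notation L1 f := (mu.-integrable setT (EFin \o f)).
Implicit Types (f : R -> R) (x t z : R).
Variable g : R -> R.
Hypothesis mg : measurable_fun setT g.
Hypothesis g_le0 : forall x : R, x <= 0 -> g x = 0.
Hypothesis ixg : L1 (fun x => x * g x).

(** The candidate for [u] when [g] is its weak derivative. Only [x * g x] is integrable near the
    origin, so the tail of [g] may diverge at [0]; the factor confines the function to the
    half-line. *)
Definition primitive_infty x : R := - ((0 < x)%R%:R * tail g x).
Notation U := primitive_infty.

Lemma primitive_infty_le0 x : x <= 0 -> U x = 0.
Proof. by move=> x0; rewrite /U ltNge x0 mul0r oppr0. Qed.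

Lemma measurable_primitive_infty : measurable_fun setT U.
Proof.
apply: measurableT_comp => //; apply: measurable_funM.
  exact: measurable_gt_indic.
exact: measurable_tail.
Qed.

(** Fubini on [x < t < z]: each [z] is weighted by the length [z - x] of the range of [t]. Since
    [0 <= x], this is at most [z], which is the weight against which [g] is integrable. *)
Lemma fubini_tail_primitive x : 0 <= x ->
  L1 (fun t => (x < t)%R%:R * U t) /\ tail U x = - tail (fun z => g z * (z - x)) x.
Proof.
move=> x0.
(* [g z != 0] forces [0 < z], so [z] also bounds the length [0] of an empty range. *)
have c_le z : g z != 0 ->
    (\int[mu]_t `|(t < z)%R%:R * (x < t)%R%:R|%:E <= z%:E)%E.
  move=> gz; have z0 : 0 < z.
    by rewrite ltNge; apply: contra gz => /g_le0 ->.
  have -> : (\int[mu]_t `|(t < z)%R%:R * (x < t)%R%:R|%:E =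
             \int[mu]_t ((t < z)%R%:R * (x < t)%R%:R : R)%:E)%E.
    by apply: eq_integral => t _; rewrite ger0_norm.
  rewrite integral_itv_indic lee_fin; case: ltP => _; rewrite ?mul0r ?mul1r; lra.
have igx : L1 (fun z => g z * z).
  by apply: eq_integrable ixg => // z _ /=; rewrite mulrC.
have [i1 _ e] := fubini_triangle (fun t => (x < t)%R%:R) g id
  (measurable_gt_indic x) mg c_le igx.
have eU t : (x < t)%R%:R * U t = - ((x < t)%R%:R * tail g t).
  by rewrite /U; case: ltP => xt; rewrite ?mul0r ?oppr0// (le_lt_trans x0 xt) !mul1r.
split.
  have := integrableN i1.
  by apply: eq_integrable => // t _ /=; rewrite eU.
transitivity (\int[mu]_t (-1 * ((x < t)%R%:R * tail g t))).
  by apply: eq_Rintegral => t _; rewrite eU mulN1r.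
rewrite RintegralZl// e mulN1r; congr (- _); apply: eq_Rintegral => z _.
rewrite mulrCA; congr (_ * _).
by rewrite /Rintegral integral_itv_indic.
Qed.

Lemma integrable_primitive_infty : L1 U.
Proof.
have [i _] := fubini_tail_primitive 0 (lexx 0).
apply: eq_integrable i => // x _ /=.
by case: ltP => x0; rewrite ?mul1r// primitive_infty_le0// mulr0.
Qed.

(* [v = (x U)'] *)
Let v x := U x + x * g x.

Lemma integrable_deriv_id_mul : L1 v.
Proof. exact: integrableD integrable_primitive_infty ixg. Qed.

(** The tail of [U] contributes minus the integral of [g z * (z - x)]; its part in [z * g z]
    cancels, leaving [x * tail g x]. *)
Lemma tail_deriv_id_mul x : 0 <= x -> tail v x = - (x * U x).
Proof.
move=> x0; have [i e] := fubini_tail_primitive x x0.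
have ig := integrable_gt_indic _ x ixg.
(* Beyond [x] one has [x <= z], so [z * g z] dominates. *)
have ixg' : L1 (fun z => x * ((x < z)%R%:R * g z)).
  apply: integrable_le ixg _ => //.
    by apply: measurable_funM => //; apply: measurable_funM => //; exact: measurable_gt_indic.
  move=> z; case: ltP => xz; rewrite ?mul0r ?mulr0 ?normr0// mul1r !normrM ler_wpM2r//.
  by rewrite !ger0_norm//; lra.
transitivity (\int[mu]_z ((x < z)%R%:R * U z + (x < z)%R%:R * (z * g z))).
  by apply: eq_Rintegral => z _; rewrite -mulrDr.
rewrite RintegralD// -[X in X + _]/(tail U x) e.
have -> : tail (fun z => g z * (z - x)) x =
    \int[mu]_z ((x < z)%R%:R * (z * g z) - x * ((x < z)%R%:R * g z)).
  by apply: eq_Rintegral => z _; ring.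
rewrite RintegralB// measurable_RintegralZl; last first.
  by apply: measurable_funM => //; exact: measurable_gt_indic.
(* At [x = 0] the cut-off in [U] departs from the tail, but the factor [x] annihilates both. *)
rewrite -/(tail g x) /U; move: x0; rewrite le_eqVlt => /predU1P[<-|->].
  by rewrite !mul0r; ring.
by rewrite mul1r; ring.
Qed.

(** [x * U x] is up to sign a tail of the integrable [v]. Its boundedness makes products with
    integrable functions integrable. *)
Lemma norm_id_mul_primitive_le x : `|x * U x| <= \int[mu]_y `|v y|.
Proof.
have [x0|x0] := leP x 0.
  rewrite primitive_infty_le0// mulr0 normr0; exact: Rintegral_ge0.
rewrite -normrN -tail_deriv_id_mul; last exact: ltW.
exact/norm_tail_le/integrable_deriv_id_mul.
Qed.

Lemma measurable_id_mul_primitive : measurable_fun setT (fun x => x * U x).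
Proof. by apply: measurable_funM => //; exact: measurable_primitive_infty. Qed.

Lemma integrable_id_mul_primitive_mul f : L1 f -> L1 (fun x => x * U x * f x).
Proof.
move=> i; apply: integrable_bounded_mul i norm_id_mul_primitive_le.
exact: measurable_id_mul_primitive.
Qed.

(* [x U (x U)' = ((x U)^2)' / 2], and [x U] vanishes at both ends of the half-line. *)
Lemma integral_id_mul_primitive_deriv : \int[mu]_x (x * U x * v x) = 0.
Proof.
have [_] := integral_mul_tail v integrable_deriv_id_mul.
have v0 x : x <= 0 -> v x = 0.
  by move=> x0; rewrite /v primitive_infty_le0// g_le0// mulr0 addr0.
(* As [v] vanishes for [x <= 0], its integral is its tail at [0], that is [- (0 * U 0)]. *)
have -> : \int[mu]_x v x = 0.
  transitivity (tail v 0); last by rewrite tail_deriv_id_mul// mul0r oppr0.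
  apply: eq_Rintegral => x _; case: ltP => x0; rewrite ?mul1r//.
  by rewrite v0// mulr0.
rewrite expr0n => /eqP; rewrite mulf_eq0 pnatr_eq0/= => /eqP e.
rewrite -[RHS]oppr0 -{}e -mulN1r -RintegralZl//; last first.
  by have [] := integral_mul_tail v integrable_deriv_id_mul.
apply: eq_Rintegral => x _; have [x0|x0] := leP x 0.
  by rewrite v0// mul0r !mulr0.
by rewrite tail_deriv_id_mul ?ltW//; ring.
Qed.

End decaying_primitive.

(** * Calculus of smooth functions and the flat exponential *)

Section smooth_functions.
Context {R : realType}.
Implicit Types (f g : R -> R) (x : R) (p : {poly R}).

Definition smooth f := forall n x, derivable (derive1n n f) x 1.

Lemma derive1_is_derive f g : (forall x, is_derive x 1 f (g x)) -> derive1 f = g.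
Proof. by move=> d; apply/funext => x; rewrite derive1E; have [_ ->] := d x. Qed.

Lemma derive1n_deriv f n : derive1n n (derive1 f) = derive1n n.+1 f.
Proof. by rewrite /derive1n -iterSr. Qed.

(** Iterated derivatives never leave a class closed under differentiation, so none has to be
    computed. *)
Lemma smooth_class (P : (R -> R) -> Prop) :
  (forall f, P f -> exists2 g, P g & forall x, is_derive x 1 f (g x)) ->
  forall f, P f -> smooth f.
Proof.
move=> cP f Pf n; suff : P (derive1n n f).
  by move=> /cP[g _ d] x; have [] := d x.
elim: n => [|n /cP[g Pg /derive1_is_derive e]]; first by [].
by rewrite derive1nS e.
Qed.

Lemma smooth_derivable f x : smooth f -> derivable f x 1.
Proof. by move=> /(_ 0%N x). Qed.

Lemma smooth_is_derive f x : smooth f -> is_derive x 1 f (derive1 f x).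
Proof. by move=> sf; split; [exact: smooth_derivable|rewrite derive1E]. Qed.

Lemma smooth_derive1 f : smooth f -> smooth (derive1 f).
Proof. by move=> sf n x; rewrite derive1n_deriv; exact: sf. Qed.

Lemma smooth_continuous f : smooth f -> continuous f.
Proof.
by move=> sf x; apply/differentiable_continuous/derivable1_diffP/smooth_derivable.
Qed.

Lemma smooth_antiderivative f g : (forall x, is_derive x 1 f (g x)) ->
  smooth g -> smooth f.
Proof.
move=> d sg [|n] x; first by have [] := d x.
by rewrite -derive1n_deriv (derive1_is_derive _ _ d); exact: sg.
Qed.

(** Closure under sums as well as products absorbs the Leibniz rule, as [smooth_class] requires. *)
Inductive smooth_algebra : (R -> R) -> Prop :=
| smooth_algebra_gen f : smooth f -> smooth_algebra f
| smooth_algebra_add f g : smooth_algebra f -> smooth_algebra g ->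
    smooth_algebra (fun x => f x + g x)
| smooth_algebra_mul f g : smooth_algebra f -> smooth_algebra g ->
    smooth_algebra (fun x => f x * g x).

Lemma smooth_algebra_smooth f : smooth_algebra f -> smooth f.
Proof.
apply: smooth_class => {}f.
elim=> {f} [f sf|f g sf [f' sf' df] sg [g' sg' dg]|f g sf [f' sf' df] sg [g' sg' dg]].
- exists (derive1 f); first exact/smooth_algebra_gen/smooth_derive1.
  by move=> x; exact: smooth_is_derive.
- exists (fun x => f' x + g' x); first exact: smooth_algebra_add.
  by move=> x; apply: is_deriveD.
- exists (fun x => f x * g' x + g x * f' x).
    by apply: smooth_algebra_add; exact: smooth_algebra_mul.
  by move=> x; apply: is_deriveM.
Qed.

Lemma smoothD f g : smooth f -> smooth g -> smooth (fun x => f x + g x).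
Proof.
by move=> sf sg; apply/smooth_algebra_smooth/smooth_algebra_add; exact: smooth_algebra_gen.
Qed.

Lemma smoothM f g : smooth f -> smooth g -> smooth (fun x => f x * g x).
Proof.
by move=> sf sg; apply/smooth_algebra_smooth/smooth_algebra_mul; exact: smooth_algebra_gen.
Qed.

Lemma smooth_horner p : smooth (horner p).
Proof.
apply: (smooth_class (fun f => exists q, f = horner q)); last by exists p.
by move=> _ [q ->]; exists (horner q^`()); [exists q^`()|move=> x; exact: is_derive_poly].
Qed.

Lemma smooth_cst (c : R) : smooth (fun=> c).
Proof.
by rewrite (_ : (fun=> c) = horner c%:P); [exact: smooth_horner|apply/funext => x; rewrite hornerC].
Qed.

Lemma smooth_id : smooth (fun x => x).
Proof.
rewrite (_ : (fun x => x) = horner 'X); first exact: smooth_horner.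
by apply/funext => x; rewrite hornerX.
Qed.

Lemma smooth_affine f (a b : R) : smooth f -> smooth (fun x => f (a * x + b)).
Proof.
(* Each differentiation brings out a factor [a], absorbed by the scalar [cg.1]. *)
move=> sf; apply: (smooth_class (fun h => exists2 cg : R * (R -> R), smooth cg.2 &
  h = fun x => cg.1 * cg.2 (a * x + b))); last first.
  by exists (1, f) => //; apply/funext => x /=; rewrite mul1r.
move=> _ [[c g] /= sg ->]; exists (fun x => c * a * derive1 g (a * x + b)).
  by exists (c * a, derive1 g) => //=; exact: smooth_derive1.
move=> x; have dg := smooth_is_derive _ (a * x + b) sg.
have da : is_derive x 1 (fun x => a * x + b) a.
  by apply: is_derive_eq; rewrite /GRing.scale/=; ring.
have dc := @is_derive1_comp _ g (fun x => a * x + b) x _ _ dg da.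
have := @is_deriveZ _ _ _ _ c _ _ _ dc.
by move/is_derive_eq; apply; rewrite /GRing.scale/=; ring.
Qed.

(* A family closed under differentiation, also at [0] since [expR] beats polynomials. *)
Definition flat_exp p x : R := if 0 < x then p.[x^-1] * expR (- x^-1) else 0.

(** A single term of the exponential series already dominates the power. *)
Lemma expr_mul_expRN_le (t : R) n : 0 <= t -> t ^+ n * expR (- t) <= n`!%:R.
Proof.
move=> t0; rewrite expRN ler_pdivrMr ?expR_gt0//; case: n => [|n].
  by rewrite expr0 mul1r -expR0 ler_expR.
rewrite -ler_pdivrMl ?ltr0n ?fact_gt0//.
by have := expR_ge1Dxn n t0; rewrite [_^-1 * _]mulrC; lra.
Qed.

Lemma horner_mul_expRN_bounded p :
  exists C : R, forall t, 0 < t -> `|p.[t] * expR (- t)| <= C.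
Proof.
exists (\sum_(i < size p) `|p`_i| * (i`!)%:R) => t t0.
rewrite horner_coef mulr_suml (le_trans (ler_norm_sum _ _ _))//.
apply: ler_sum => i _; rewrite -mulrA normrM ler_wpM2l//.
rewrite ger0_norm; first exact: expr_mul_expRN_le (ltW t0).
by rewrite mulr_ge0 ?expR_ge0// exprn_ge0// ltW.
Qed.

(** In the variable [t = x^-1] the chain rule replaces [p] by [t^2 (p - p')]. At [0] the difference
    quotient vanishes in the limit by exponential decay. *)
Lemma is_derive_flat_exp p x :
  is_derive x 1 (flat_exp p) (flat_exp ('X ^+ 2 * (p - p^`())) x).
Proof.
have [x0|x0|->] := ltgtP x 0.
- rewrite {2}/flat_exp ltNge ltW//=.
  apply: (near_eq_is_derive (f := cst 0)).
  near=> y; rewrite /flat_exp ifF//; apply/negbTE; rewrite -leNgt ltW//.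
  by near: y; exact: lt_nbhsl.
- rewrite {2}/flat_exp x0.
  apply: (near_eq_is_derive (f := fun y : R => p.[y^-1] * expR (- y^-1))).
    near=> y; rewrite /flat_exp ifT//.
    by near: y; exact: lt_nbhsr.
  have xn0 : x != 0 by rewrite gt_eqF.
  have dV := is_deriveV xn0 (is_derive_id x (1 : R)).
  have d1 := @is_derive1_comp _ (horner p) _ x _ _ (is_derive_poly p x^-1) dV.
  have d2 := @is_derive1_comp _ expR _ x _ _ (is_derive_expR _) (is_deriveN dV).
  have := is_deriveM d1 d2; move/is_derive_eq; apply.
  by rewrite /GRing.scale/= !hornerE/=; field.
- rewrite {2}/flat_exp ltxx.
  (* The difference quotient at [h > 0] is [h] times the bounded expression attached to
     [p * 'X ^+ 2]. *)
  have [C hC] := horner_mul_expRN_bounded (p * 'X ^+ 2).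
  have hcvg : (fun h : R => h^-1 *: (flat_exp p (h *: 1 + 0) - flat_exp p 0)) @ 0^' --> 0.
    apply/cvgr0Pnorm_lt => e e0; near=> h.
    have hn0 : h != 0 by near: h; exact: nbhs_dnbhs_neq.
    rewrite /flat_exp ltxx subr0 addr0 /GRing.scale/= mulr1.
    case: (ltP 0 h) => [h0|_]; last by rewrite mulr0 normr0.
    have := hC h^-1; rewrite invr_gt0 => /(_ h0) hCh.
    have he : `|h| < e / (`|C| + 1).
      by near: h; apply: dnbhs0_lt; rewrite divr_gt0// ltr_pwDr.
    have -> : h^-1 * (p.[h^-1] * expR (- h^-1)) =
        h * ((p * 'X^2).[h^-1] * expR (- h^-1)).
      by rewrite !hornerE/=; field.
    rewrite normrM; apply: (@le_lt_trans _ _ (`|h| * (`|C| + 1))).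
      by rewrite ler_wpM2l// (le_trans hCh)// (le_trans (ler_norm C))// lerDl.
    by rewrite -ltr_pdivlMr// ltr_pwDr.
  split; first by apply/cvg_ex; exists 0.
  exact/cvg_lim.
Unshelve. all: by end_near.
Qed.

Lemma smooth_flat_exp p : smooth (flat_exp p).
Proof.
apply: (smooth_class (fun f => exists q, f = flat_exp q)); last by exists p.
move=> _ [q ->]; exists (flat_exp ('X ^+ 2 * (q - q^`()))); first by eexists.
by move=> x; exact: is_derive_flat_exp.
Qed.

End smooth_functions.

(** * Test functions on the half-line *)

Section test_functions.
Context {R : realType}.
Notation mu := (@lebesgue_measure R).
Notation L1 f := (mu.-integrable setT (EFin \o f)).
Implicit Types (f phi psi : R -> R) (x y a b : R).

Lemma halflineE x : halfline R x = (0 < x) :> Prop.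
Proof. by rewrite /halfline /= in_itv/= andbT. Qed.

Lemma test_functionI phi a b : 0 < a -> smooth phi ->
  (forall x, phi x != 0 -> a <= x <= b) -> test_function phi.
Proof.
move=> a0 sphi supp.
have sub : closure [set x | phi x != 0] `<=` `[a, b].
  rewrite (closure_id `[a, b]).1; last exact: itv_closed.
  by apply: closure_subset => x /=; rewrite in_itv/=; exact: supp.
split => //.
  by apply: (subclosed_compact _ (@segment_compact R a b) sub); exact: closed_closure.
by move=> x /sub /=; rewrite halflineE in_itv/= => /andP[/(lt_le_trans a0)].
Qed.

Lemma test_function_smooth phi : test_function phi -> smooth phi.
Proof. by case. Qed.

(** The closed support misses [0], hence a whole ball around it, which gives the left end;
    compactness gives the right end. *)
Lemma test_function_support phi : test_function phi ->
  exists2 ab : R * R, 0 < ab.1 & forall x, phi x != 0 -> ab.1 <= x <= ab.2.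
Proof.
move=> [_ cK KH].
have [M [_ hM]] := compact_bounded cK.
have oK : open (~` closure [set x | phi x != 0]).
  by apply: closed_openC; exact: closed_closure.
have nK0 : (~` closure [set x | phi x != 0]) 0.
  by move=> /KH; rewrite halflineE ltxx.
have := open_nbhs_nbhs (conj oK nK0); rewrite -nbhs_ballE => -[e /= e0 he].
exists (e, M + 1) => //= x phix.
have Kx : closure [set x | phi x != 0] x by exact: subset_closure.
have x0 : 0 < x by have := KH _ Kx; rewrite halflineE.
apply/andP; split.
  rewrite leNgt; apply/negP => xe; apply: (he x) => //.
  by rewrite /ball/= sub0r normrN gtr0_norm.
by rewrite (le_trans (ler_norm x))// (hM (M + 1))// ltrDl.
Qed.

Lemma test_function_bounded phi : test_function phi -> exists C, forall x, `|phi x| <= C.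
Proof.
move=> tphi; have [[a b] /= a0 supp] := test_function_support phi tphi.
have cphi := smooth_continuous _ (test_function_smooth _ tphi).
have /compact_bounded[M [_ hM]] : compact (phi @` `[a, b]).
  by apply: continuous_compact; [exact: continuous_subspaceT|exact: segment_compact].
exists (`|M| + 1) => x; have [->|/supp xab] := eqVneq (phi x) 0.
  by rewrite normr0 addr_ge0.
apply: (hM (`|M| + 1)); last by exists x => //=; rewrite in_itv.
by rewrite (le_lt_trans (ler_norm M))// ltrDl.
Qed.

Lemma measurable_test_function phi : test_function phi -> measurable_fun setT phi.
Proof.
by move=> /test_function_smooth /smooth_continuous; exact: continuous_measurable_fun.
Qed.

Lemma test_function_le0 phi x : test_function phi -> x <= 0 -> phi x = 0.
Proof.
move=> /test_function_support[[a b] /= a0 supp] x0; apply/eqP.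
apply: contraTT x0 => /supp /andP[ax _]; rewrite -ltNge; exact: lt_le_trans ax.
Qed.

Lemma test_function_combination phi psi (c : R) : test_function phi -> test_function psi ->
  test_function (fun x => phi x + c * psi x).
Proof.
move=> tphi tpsi.
have [[a b] /= a0 supp] := test_function_support phi tphi.
have [[a' b'] /= a'0 supp'] := test_function_support psi tpsi.
apply: (test_functionI _ (Num.min a a') (Num.max b b')).
- by rewrite lt_min a0.
- apply: smoothD; first exact: test_function_smooth.
  by apply: smoothM; [exact: smooth_cst|exact: test_function_smooth].
- move=> x; rewrite ge_min le_max; have [->|/supp /andP[-> ->]//] := eqVneq (phi x) 0.
  rewrite add0r mulf_eq0 negb_or => /andP[_ /supp' /andP[-> ->]].
  by rewrite !orbT.
Qed.

Lemma test_function_id_mul phi : test_function phi -> test_function (fun x => x * phi x).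
Proof.
move=> tphi; have [[a b] /= a0 supp] := test_function_support phi tphi.
apply: (test_functionI _ a b) => //.
  by apply: smoothM; [exact: smooth_id|exact: test_function_smooth].
by move=> x; rewrite mulf_eq0 negb_or => /andP[_ /supp].
Qed.

Lemma derive1_id_mul phi x : smooth phi ->
  derive1 (fun x => x * phi x) x = x * derive1 phi x + phi x.
Proof.
move=> sphi; have := smooth_is_derive _ x sphi => d.
rewrite derive1E; have [_ ->] := is_deriveM (is_derive_id x (1 : R)) d.
by rewrite /GRing.scale/= mulr1.
Qed.

Lemma test_function_derive1 phi : test_function phi -> test_function (derive1 phi).
Proof.
move=> tphi; have [[a b] /= a0 supp] := test_function_support phi tphi.
apply: (test_functionI _ a b) => //.
  exact/smooth_derive1/test_function_smooth.
move=> x; apply: contraNT => xab.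
rewrite derive1E (near_eq_derive (g := cst 0)) ?derive_cst//.
have oC : open (~` `[a, b]) by apply: closed_openC; exact: itv_closed.
have xC : (~` `[a, b]) x by rewrite /= in_itv/=; exact/negP.
have := open_nbhs_nbhs (conj oC xC); apply: filterS => y /= yab.
by apply/eqP; apply: contra_notT yab => /supp; rewrite in_itv.
Qed.

Lemma integrable_test_function phi : test_function phi -> L1 phi.
Proof.
move=> tphi; have [[a b] /= a0 supp] := test_function_support phi tphi.
have [C hC] := test_function_bounded phi tphi.
have iab : L1 (\1_`[a, b] : R -> R) by exact: integrable_indic_itv.
have := integrable_bounded_mul mu C _ _ (measurable_test_function _ tphi) iab hC.
apply: eq_integrable => // x _ /=; rewrite indicE mem_setE in_itv/=.
by have [->|/supp ->] := eqVneq (phi x) 0; rewrite ?mul0r ?mulr1.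
Qed.

Lemma flat_exp1_ge0_le1 x : 0 <= flat_exp 1 x <= 1.
Proof.
rewrite /flat_exp; case: ltP => x0; rewrite ?lexx ?ler01//.
by rewrite hornerC mul1r expR_ge0/= -expR0 ler_expR oppr_le0 invr_ge0 ltW.
Qed.

(** For [0 < x] the value is the exponential of [- 1 / ((n + 1) x)], which tends to [1]. *)
Lemma flat_exp1_cvg x : flat_exp 1 (n.+1%:R * x) @[n --> \oo] --> ((0 < x)%R%:R : R).
Proof.
have [x0|x0] := ltP 0 x; last first.
  rewrite (_ : (fun n => _) = cst 0); first exact: cvg_cst.
  apply/funext => n; rewrite /flat_exp ifF//; apply/negbTE; rewrite -leNgt.
  by rewrite mulr_ge0_le0.
rewrite (_ : (fun n => _) = (fun n : nat => expR (- (n.+1%:R^-1 * x^-1)))).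
  rewrite [X in _ --> X](_ : _ = expR (- (0 * x^-1))); last by rewrite mul0r oppr0 expR0.
  apply: continuous_cvg; first exact: continuous_expR.
  by apply: cvgN; apply: cvgMl; exact: cvg_harmonic.
apply/funext => n; rewrite /flat_exp mulr_gt0 ?ltr0n// hornerC mul1r invfM//.
Qed.

(** Smooth approximations of the indicator of []a, b[], dominated by it and converging to it
    pointwise. *)
Definition smooth_bump a b (n : nat) x : R :=
  flat_exp 1 (n.+1%:R * (x - a)) * flat_exp 1 (n.+1%:R * (b - x)).

Lemma flat_exp_neq0 p x : flat_exp p x != 0 -> 0 < x.
Proof. by rewrite /flat_exp; case: ltP => //; rewrite eqxx. Qed.

Lemma smooth_bump_support a b n x : smooth_bump a b n x != 0 -> a < x < b.
Proof.
rewrite mulf_eq0 negb_or => /andP[/flat_exp_neq0 + /flat_exp_neq0].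
by rewrite !pmulr_rgt0 ?ltr0n// !subr_gt0 => -> ->.
Qed.

Lemma test_function_smooth_bump a b n : 0 < a -> test_function (smooth_bump a b n).
Proof.
move=> a0; apply: (test_functionI _ a b) => //; last first.
  by move=> x /smooth_bump_support /andP[/ltW-> /ltW->].
have e1 : (fun x => flat_exp 1 (n.+1%:R * (x - a))) =
    (fun x => flat_exp 1 (n.+1%:R * x + (- n.+1%:R * a))).
  by apply/funext => x; congr flat_exp; ring.
have e2 : (fun x => flat_exp 1 (n.+1%:R * (b - x))) =
    (fun x => flat_exp 1 (- n.+1%:R * x + (n.+1%:R * b))).
  by apply/funext => x; congr flat_exp; ring.
by apply: smoothM; rewrite ?e1 ?e2; exact: (smooth_affine _ _ _ (smooth_flat_exp 1)).
Qed.

Lemma norm_smooth_bump_le a b n x : `|smooth_bump a b n x| <= \1_`]a, b[%classic x.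
Proof.
rewrite indicE mem_setE in_itv/=.
have [->|nz] := eqVneq (smooth_bump a b n x) 0; first by rewrite normr0.
rewrite (smooth_bump_support _ _ _ _ nz) /smooth_bump normrM.
have /andP[h1 h2] := flat_exp1_ge0_le1 (n.+1%:R * (x - a)).
have /andP[h3 h4] := flat_exp1_ge0_le1 (n.+1%:R * (b - x)).
by rewrite !ger0_norm// mulr_ile1.
Qed.

Lemma smooth_bump_cvg a b x : smooth_bump a b n x @[n --> \oo] --> (\1_`]a, b[%classic x : R).
Proof.
rewrite [X in _ --> X](_ : _ = (0 < x - a)%R%:R * (0 < b - x)%R%:R).
  by apply: cvgM; exact: flat_exp1_cvg.
rewrite indicE mem_setE in_itv/= !subr_gt0.
by case: (a < x); case: (x < b); rewrite ?mul0r ?mul1r.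
Qed.

(** The zero mean is what makes the primitive compactly supported. *)
Lemma test_function_antiderivative psi : test_function psi -> \int[mu]_x psi x = 0 ->
  exists2 phi, test_function phi &
    (forall x, derive1 phi x = psi x) /\
    forall y, phi y = \int[mu]_x ((x < y)%R%:R * psi x).
Proof.
move=> tpsi psi0; have [[a b] /= a0 supp] := test_function_support psi tpsi.
have ipsi := integrable_test_function psi tpsi.
pose phi y := \int[mu]_x ((x < y)%R%:R * psi x).
have phiE y : phi y = \int[mu]_(x in `]-oo, y]) psi x.
  rewrite -Rintegral_itv_bndo_bndc; last exact: integrableS ipsi.
  rewrite Rintegral_mkcond; apply: eq_Rintegral => x _.
  by rewrite patchE mem_setE in_itv/=; case: ltP; rewrite ?mul1r ?mul0r.
have d y : is_derive y 1 phi (psi y).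
  have cpsi : {for y, continuous psi}.
    exact: smooth_continuous (test_function_smooth _ tpsi) y.
  have y1 : y < y + 1 by rewrite ltrDl.
  have iy : mu.-integrable `]-oo, y + 1] (EFin \o psi) by exact: integrableS ipsi.
  have [d1 d2] := continuous_FTC1 y1 iy (ltNyr y) cpsi.
  rewrite (_ : phi = fun y => \int[mu]_(x in `]-oo, y]) psi x); last exact/funext.
  by split => //; rewrite -derive1E.
exists phi; last by split => // x; rewrite (derive1_is_derive _ _ d).
apply: (test_functionI _ a b) => //.
  exact: smooth_antiderivative d (test_function_smooth _ tpsi).
(* Left of [a] nothing has been integrated yet; right of [b] the whole integral has been, and it is
   zero. *)
move=> y; apply: contraNT; rewrite negb_and -!ltNge => /orP[ya|by_].
  rewrite /phi (_ : (fun x => _) = cst 0) ?Rintegral_cst ?mul0r//.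
  apply/funext => x /=; case: ltP => xy; rewrite ?mul0r// mul1r; apply/eqP.
  by apply: contraTT ya => /supp /andP[ax _]; rewrite -leNgt ltW// (le_lt_trans ax).
rewrite /phi (_ : (fun x => _) = psi) ?psi0//.
apply/funext => x /=; case: ltP => yx; rewrite ?mul1r// mul0r; apply/esym/eqP.
by apply: contraTT by_ => /supp /andP[_ xb]; rewrite -leNgt (le_trans yx).
Qed.

End test_functions.

(** * Weak derivatives and the fundamental lemma of the calculus of variations *)

Section weak_derivatives.
Context {R : realType}.
Notation mu := (@lebesgue_measure R).
Notation L1 f := (mu.-integrable setT (EFin \o f)).
Implicit Types (d f phi psi : R -> R) (x y a b : R).

(** [f] is bounded and lives on a compact subset of the half-line, where [d] is integrable. *)
Lemma integrable_locally_mul d f a b (C : R) : locally_integrable (halfline R) d ->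
  0 < a -> measurable_fun setT f -> (forall x, `|f x| <= C) ->
  (forall x, f x != 0 -> a <= x <= b) -> L1 (fun x => d x * f x).
Proof.
move=> [md _ locd] a0 mf fC supp.
have sub : `[a, b] `<=` halfline R.
  by move=> x; rewrite halflineE /= in_itv/= => /andP[/(lt_le_trans a0)].
have iK : mu.-integrable `[a, b] (EFin \o d).
  apply/integrableP; split.
    apply/measurable_EFinP; apply: measurable_funS md => //.
    exact: measurable_itv.
  by apply: locd => //; exact: segment_compact.
have : L1 (d \_ `[a, b]).
  rewrite -restrict_EFin; exact/(integrable_mkcond _ _).1.
move=> /(integrable_bounded_mul mu C _ _ mf) /(_ fC).
apply: eq_integrable => // x _ /=; rewrite patchE mem_setE in_itv/=; congr (_%:E).
have [->|/supp ->] := eqVneq (f x) 0; first by rewrite mul0r mulr0.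
by rewrite mulrC.
Qed.

Lemma integrable_mul_test_function d phi : locally_integrable (halfline R) d ->
  test_function phi -> L1 (fun x => d x * phi x).
Proof.
move=> ld tphi; have [[a b] /= a0 supp] := test_function_support phi tphi.
have [C hC] := test_function_bounded phi tphi.
exact: (integrable_locally_mul _ _ a b C ld a0 (measurable_test_function _ tphi)).
Qed.

Lemma Rintegral_halfline f : (forall x, x <= 0 -> f x = 0) ->
  \int[mu]_(x in halfline R) f x = \int[mu]_x f x.
Proof.
move=> f0; rewrite Rintegral_mkcond; apply: eq_Rintegral => x _.
rewrite patchE; case: ifPn => //; rewrite notin_setE halflineE => /negP.
by rewrite -leNgt => /f0.
Qed.

Lemma weak_derivative_test u v phi : weak_derivative u v -> test_function phi ->
  \int[mu]_x (u x * derive1 phi x) = - \int[mu]_x (v x * phi x).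
Proof.
move=> [_ _ h] tphi; rewrite -Rintegral_halfline; last first.
  by move=> x x0; rewrite (test_function_le0 _ _ (test_function_derive1 _ tphi))// mulr0.
rewrite h// Rintegral_halfline// => x x0.
by rewrite (test_function_le0 _ _ tphi)// mulr0.
Qed.

Section vanishing.
Variable d : R -> R.
Hypothesis ld : locally_integrable (halfline R) d.
Hypothesis d0 : forall phi, test_function phi -> \int[mu]_x (d x * phi x) = 0.

Let integrable_itv a b : 0 < a -> L1 (fun x => d x * \1_`]a, b[%classic x).
Proof.
move=> a0; apply: (integrable_locally_mul _ _ a b 1) => //.
- by move=> x; rewrite indicE; exact: norm_bool_natr.
- move=> x; rewrite indicE mem_setE in_itv/=; case: (boolP (_ && _)) => [/andP[ax xb] _|].
    by rewrite !ltW.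
  by rewrite eqxx.
Qed.

(** Dominated convergence along the smooth bumps, each of which [d] annihilates. *)
Lemma integral_itv_eq0 a b : 0 < a -> \int[mu]_x (d x * \1_`]a, b[%classic x) = 0.
Proof.
move=> a0.
have i0 n := integrable_mul_test_function _ _ ld (test_function_smooth_bump a b n a0).
have [|||||_ _ h] := @dominated_convergence _ _ _ mu setT measurableT
  (fun n x => (d x * smooth_bump a b n x)%:E)
  (fun x => (d x * \1_`]a, b[%classic x)%:E)
  (fun x => `|d x * \1_`]a, b[%classic x|%:E).
- by move=> n; exact: measurable_int (i0 n).
- exact: measurable_int (integrable_itv a b a0).
- apply: aeW => x _; apply: cvg_EFin; first exact: nearW.
  by apply: cvgMr; exact: smooth_bump_cvg.
- exact: integrable_norm (integrable_itv a b a0).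
- apply: aeW => x n _; rewrite lee_fin !(normrM (d x)) ler_wpM2l//.
  by rewrite (le_trans (norm_smooth_bump_le _ _ _ _))// ler_norm.
rewrite /Rintegral.
move: h; rewrite (_ : (fun n => _) = cst 0%E); last first.
  apply/funext => n /=; rewrite -[LHS]fineK ?(integrable_fin_num _ (i0 n))//.
  by rewrite -/(Rintegral _ _ _) d0//; exact: test_function_smooth_bump.
by move=> /cvg_lim; rewrite lim_cst// => <-.
Qed.

(** The integrals of [d] over intervals vanish, so its cut-off to []a, b[] has a zero primitive, and
    Lebesgue differentiation gives zero almost everywhere there. Countably many such intervals
    exhaust the half-line. *)
Lemma ae_eq0_of_test_functions : {ae mu, forall x, 0 < x -> d x = 0}.
Proof.
suff h : forall m : nat, {ae mu, forall x, m.+1%:R^-1 < x < m.+1%:R -> d x = 0}.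
  have := @ae_foralln _ _ _ mu (fun m x => m.+1%:R^-1 < x < m.+1%:R -> d x = 0) h.
  (* An index exceeding both [x] and [x^-1] places [x] in the interval. *)
  apply: ae_imply => x hx x0; apply: (hx (maxn (Num.bound x) (Num.bound x^-1))).
  apply/andP; split.
    rewrite invf_plt ?posrE ?ltr0n//; apply: (lt_le_trans (archi_boundP _)).
      by rewrite invr_ge0 ltW.
    by rewrite ler_nat leqW// leq_maxr.
  apply: (lt_le_trans (archi_boundP (ltW x0))).
  by rewrite ler_nat leqW// leq_maxl.
move=> m; set a := m.+1%:R^-1; set b := m.+1%:R.
have a0 : 0 < a by rewrite invr_gt0 ltr0n.
pose f x := d x * \1_`]a, b[%classic x.
have i_f : L1 f by exact: integrable_itv.
(* Cutting []a, b[] at [y] gives the interval from [a] to [Num.min y b]. *)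
have F0 y : \int[mu]_(x in `]-oo, y]) f x = 0.
  rewrite -Rintegral_itv_bndo_bndc; last exact: integrableS i_f.
  rewrite -(integral_itv_eq0 a (Num.min y b) a0) Rintegral_mkcond.
  apply: eq_Rintegral => x _; rewrite patchE mem_setE in_itv/= /f !indicE !mem_setE !in_itv/=.
  by rewrite lt_min; case: (x < y); case: (a < x); rewrite ?mulr0.
have lf : locally_integrable setT f by apply: open_integrable_locally => //; exact: openT.
have i_fy y : mu.-integrable `]-oo, y] (EFin \o f) by exact: integrableS i_f.
have := FTC1Ny i_fy lf.
apply: ae_imply => x [_]; rewrite (_ : (fun y => _) = cst 0); last exact/funext.
rewrite derive1_cst /f indicE mem_setE in_itv/= => e xab.
by rewrite e xab mulr1.
Qed.

End vanishing.
End weak_derivatives.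

(** * Weighted Sobolev functions as decaying primitives *)

Section weighted_sobolev.
Context {R : realType}.
Notation mu := (@lebesgue_measure R).
Notation L1 f := (mu.-integrable setT (EFin \o f)).
Implicit Types (f phi psi : R -> R) (x y a b : R).

(** Extension by zero, which moves integrals over the half-line to the whole line, where the tail
    identities are stated. *)
Definition cutoff f x : R := (0 < x)%R%:R * f x.

Lemma cutoff_gt0 f x : 0 < x -> cutoff f x = f x.
Proof. by rewrite /cutoff => ->; rewrite mul1r. Qed.

Lemma cutoff_le0 f x : x <= 0 -> cutoff f x = 0.
Proof. by rewrite /cutoff ltNge => ->; rewrite mul0r. Qed.

Lemma cutoff_restrict f : cutoff f = f \_ (halfline R).
Proof.
apply/funext => x; rewrite patchE mem_setE in_itv/= andbT /cutoff.
by case: ltP; rewrite ?mul1r ?mul0r.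
Qed.

Lemma measurable_halfline : measurable (halfline R).
Proof. exact: measurable_itv. Qed.

Lemma measurable_cutoff f : measurable_fun (halfline R) f ->
  measurable_fun setT (cutoff f).
Proof.
move=> mf; rewrite cutoff_restrict.
exact/(measurable_restrictT _ measurable_halfline).
Qed.

Lemma integrable_cutoff f :
  mu.-integrable (halfline R) (EFin \o f) <-> L1 (cutoff f).
Proof.
rewrite cutoff_restrict -restrict_EFin.
split=> h; [apply/(integrable_mkcond _ _).1|apply/(integrable_mkcond _ _).2] => //.
  exact: measurable_halfline.
exact: measurable_halfline.
Qed.

Lemma Rintegral_cutoff f :
  \int[mu]_(x in halfline R) f x = \int[mu]_x cutoff f x.
Proof. by rewrite Rintegral_mkcond -cutoff_restrict. Qed.

Lemma locally_integrable_cst (c : R) : locally_integrable (halfline R) (cst c).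
Proof.
split; [by []|exact: interval_open|move=> K _ cK].
have : mu.-integrable K (EFin \o cst c).
  by apply: continuous_compact_integrable => //; apply: continuous_subspaceT => x; exact: cvg_cst.
by case/integrableP.
Qed.

(** Otherwise the constant [1] would annihilate all test functions, and []1, 2[] would have length
    zero. *)
Lemma exists_test_function_integral_neq0 :
  exists2 psi : R -> R, test_function psi & \int[mu]_x psi x != 0.
Proof.
apply: contrapT => h.
have h0 phi : test_function phi -> \int[mu]_x (cst 1 x * phi x) = 0.
  move=> tphi; apply/eqP; apply: contra_notT h => hn; exists phi => //.
  by move: hn; under eq_Rintegral do rewrite mul1r.
have := integral_itv_eq0 _ (locally_integrable_cst 1) h0 1 2 ltr01.
have -> : \int[mu]_x (cst 1 x * \1_`]1, 2[%classic x) = \int[mu]_x ((x < 2)%R%:R * (1 < x)%R%:R).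
  apply: eq_Rintegral => x _; rewrite indicE mem_setE in_itv/= mul1r.
  by case: (1 < x); case: (x < 2); rewrite ?mulr1 ?mulr0.
rewrite /Rintegral integral_itv_indic/= ltr1n mul1r => /eqP.
by rewrite (_ : 2 - 1 = 1 :> R) ?oner_eq0//; ring.
Qed.

Section representative.
Variables u v : R -> R.
Hypothesis uv : weak_derivative u v.
Hypothesis iu : L1 (cutoff (fun x => x * u x)).
Hypothesis iv : L1 (cutoff (fun x => x * v x)).

Let g := cutoff v.
Notation U := (primitive_infty g).

Let lu : locally_integrable (halfline R) u. Proof. by case: uv. Qed.
Let lv : locally_integrable (halfline R) v. Proof. by case: uv. Qed.
Let mg : measurable_fun setT g.
Proof. by apply: measurable_cutoff; case: lv. Qed.
Let g_le0 x : x <= 0 -> g x = 0. Proof. exact: cutoff_le0. Qed.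
Let ixg : L1 (fun x => x * g x).
Proof. by apply: eq_integrable iv => // x _ /=; rewrite /g /cutoff mulrCA. Qed.

Let lU : locally_integrable (halfline R) U.
Proof.
apply: open_integrable_locally; first exact: interval_open.
apply: (@integrableS _ _ _ _ setT) => //; first exact: measurable_halfline.
exact: integrable_primitive_infty.
Qed.

(** A mean-zero [psi] is the derivative of a test function [phi]. Pairing it with [u] gives minus
    the integral of [v * phi] by definition of the weak derivative; pairing it with [U] gives the
    same by Fubini. *)
Let integral_test0 psi : test_function psi -> \int[mu]_x psi x = 0 ->
  \int[mu]_x ((u x - U x) * psi x) = 0.
Proof.
move=> tpsi psi0.
have [phi tphi [dphi phiE]] := test_function_antiderivative psi tpsi psi0.
have [C hC] := test_function_bounded psi tpsi.
have C0 : 0 <= C by rewrite (le_trans _ (hC 0)).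
have mpsi := measurable_test_function _ tpsi.
under eq_Rintegral do rewrite mulrBl.
rewrite RintegralB//; try exact: integrable_mul_test_function.
have -> : \int[mu]_x (u x * psi x) = \int[mu]_x (u x * derive1 phi x).
  by apply: eq_Rintegral => x _; rewrite dphi.
rewrite (weak_derivative_test u v)//.
(* [psi] is bounded by [C] and vanishes for [x <= 0], so the integral of its absolute value below
   [y] is at most [C * y]. *)
have [||ie _ e] := fubini_triangle psi g (fun y => C * y) mpsi mg.
- move=> y gy; have y0 : 0 < y by rewrite ltNge; apply: contra gy => /g_le0 ->.
  apply: (@le_trans _ _ (\int[mu]_x (C * ((x < y)%R%:R * (0 < x)%R%:R))%:E)%E).
    apply: ge0_le_integral => //.
    + apply/measurable_EFinP; apply: measurableT_comp => //; apply: measurable_funM => //.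
      exact: measurable_below_indic.
    + apply/measurable_EFinP; apply: measurable_funM => //.
      by apply: measurable_funM; [exact: measurable_below_indic|exact: measurable_gt_indic].
    + move=> x _; rewrite lee_fin normrM (@ger0_norm _ _%:R)// mulrCA ler_wpM2l//.
      by case: ltP => x0; rewrite ?mulr1// (test_function_le0 _ _ tpsi)// normr0 mulr0.
  under eq_integral do rewrite EFinM.
  rewrite ge0_integralZl//; last first.
    apply/measurable_EFinP; apply: measurable_funM; last exact: measurable_gt_indic.
    exact: measurable_below_indic.
  by rewrite integral_itv_indic y0 mul1r subr0 EFinM.
- apply: eq_integrable (integrableZl measurableT C ixg) => // x _ /=.
  by rewrite -EFinM; congr (_%:E); ring.
have -> : \int[mu]_x (v x * phi x) = \int[mu]_y (g y * \int[mu]_x ((x < y)%R%:R * psi x)).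
  apply: eq_Rintegral => y _; rewrite -phiE; have [y0|y0] := leP y 0.
    by rewrite (test_function_le0 _ _ tphi)// !mulr0.
  by rewrite /g cutoff_gt0.
have -> : \int[mu]_x (U x * psi x) = \int[mu]_x (-1 * (psi x * tail g x)).
  apply: eq_Rintegral => x _; have [x0|x0] := leP x 0.
    by rewrite (test_function_le0 _ _ tpsi)// mul0r !mulr0.
  by rewrite /primitive_infty x0; rewrite mul1r; ring.
by rewrite RintegralZl// -e; ring.
Qed.

(** [u - U] annihilates mean-zero test functions, hence is almost everywhere a constant on the
    half-line; integrability at infinity forces this constant to be zero. *)
Lemma weak_derivative_primitive : {ae mu, forall x, 0 < x -> u x = U x}.
Proof.
have [psi tpsi Ipsi] := exists_test_function_integral_neq0.
have lz : locally_integrable (halfline R) (fun x => u x - U x).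
  exact: locally_integrableB lu lU.
(* If [u - U] is a constant, pairing it with [psi] and dividing by the mass of [psi] recovers that
   constant. *)
pose c := (\int[mu]_x ((u x - U x) * psi x)) / \int[mu]_x psi x.
have lc := locally_integrable_cst c.
have hc : {ae mu, forall x, 0 < x -> u x - U x - c = 0}.
  apply: (ae_eq0_of_test_functions (fun x => u x - U x - c)).
    exact: locally_integrableB lz lc.
  move=> phi tphi.
  (* Chosen so that [phi + k * psi] has integral zero. *)
  pose k := - (\int[mu]_x phi x / \int[mu]_x psi x).
  have iphi := integrable_test_function _ tphi.
  have ipsi := integrable_test_function _ tpsi.
  have izphi := integrable_mul_test_function _ _ lz tphi.
  have izpsi := integrable_mul_test_function _ _ lz tpsi.
  have ikpsi : L1 (fun x => k * psi x) by exact: integrableZl ipsi.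
  have ikzpsi : L1 (fun x => k * ((u x - U x) * psi x)) by exact: integrableZl izpsi.
  have icphi : L1 (fun x => c * phi x) by exact: integrableZl iphi.
  have h0 : \int[mu]_x (phi x + k * psi x) = 0.
    by rewrite RintegralD// RintegralZl// /k; field.
  have := integral_test0 _ (test_function_combination _ _ k tphi tpsi) h0.
  under eq_Rintegral do rewrite mulrDr mulrCA.
  rewrite RintegralD// RintegralZl// => h.
  under eq_Rintegral do rewrite mulrBl.
  rewrite RintegralB// RintegralZl//.
  by move: h; rewrite /k /c => /(canRL (addrK _)) ->; field.
have c0 : c = 0.
  apply/eqP; apply/negP => /negP c0.
  (* Beyond [1] the weight [x] is at least [1], so weighted integrability of [u] gives plain
     integrability there. *)
  have iw : L1 (fun x => (1 < x)%R%:R * cutoff u x - (1 < x)%R%:R * U x).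
    have iU := integrable_primitive_infty _ mg g_le0 ixg.
    suff iu1 : L1 (fun x => (1 < x)%R%:R * cutoff u x).
      exact: integrableB iu1 (integrable_gt_indic _ 1 iU).
    apply: integrable_le iu _ => //.
      apply: measurable_funM; first exact: measurable_gt_indic.
      by apply: measurable_cutoff; case: lu.
    move=> x; rewrite /cutoff; case: ltP => x1; last by rewrite mul0r normr0.
    rewrite (lt_trans ltr01 x1) !mul1r normrM ler_peMl//.
    by rewrite ger0_norm ltW// (lt_trans ltr01).
  have : L1 (fun x => c * (1 < x)%R%:R).
    apply: ae_eq_integrable iw.
      by apply: measurable_funM => //; exact: measurable_gt_indic.
    apply: ae_imply hc => x; case: (ltP 1 x) => x1; last by rewrite !mul0r subrr mulr0.
    have x0 := lt_trans ltr01 x1.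
    by move=> /(_ x0) /eqP; rewrite subr_eq0 => /eqP <-; rewrite cutoff_gt0// !mul1r mulr1.
  move=> /(integrableZl measurableT c^-1) /integrableP[_].
  rewrite (_ : (fun x => _) = (fun x => (\1_`]1, +oo[%classic x)%:E)); last first.
    apply/funext => x /=; rewrite indicE mem_setE in_itv/= andbT mulrA mulVf// mul1r.
    by rewrite ger0_norm.
  rewrite integral_indic//.
  (* A nonzero constant is not integrable on a set of infinite measure. *)
  have : lebesgue_measure (`]1%R, +oo[%classic : set R) = +oo%E.
    by rewrite lebesgue_measure_itv/= ltry.
  by rewrite setIT => e; apply/negP; rewrite -leNgt -e.
by apply: ae_imply hc => x h x0; have := h x0; rewrite c0 subr0 => /eqP; rewrite subr_eq0 => /eqP.
Qed.

End representative.
End weighted_sobolev.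

(** * Uniqueness of weak derivatives and the derivative of [x u] *)

Section id_mul_wderiv.
Context {R : realType}.
Notation mu := (@lebesgue_measure R).
Notation L1 f := (mu.-integrable setT (EFin \o f)).

Lemma weak_derivative_wderiv (w v : R -> R) : weak_derivative w v ->
  weak_derivative w (wderiv w).
Proof. by move=> wv; apply: (@xgetPex _ (fun=> 0) [set v | weak_derivative w v]); exists v. Qed.

Lemma weak_derivative_unique (w v1 v2 : R -> R) :
  weak_derivative w v1 -> weak_derivative w v2 ->
  {ae mu, forall x, 0 < x -> v1 x = v2 x}.
Proof.
move=> w1 w2; have [_ l1 _] := w1; have [_ l2 _] := w2.
have := ae_eq0_of_test_functions (fun x => v1 x - v2 x) (locally_integrableB l1 l2).
move=> /(_ _)/ae_imply; apply.
  by move=> x h /h /eqP; rewrite subr_eq0 => /eqP.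
move=> phi tphi; under eq_Rintegral do rewrite mulrBl.
rewrite RintegralB//; try exact: integrable_mul_test_function.
have e1 := weak_derivative_test _ _ _ w1 tphi.
have e2 := weak_derivative_test _ _ _ w2 tphi.
by apply/eqP; rewrite subr_eq0 -eqr_opp -e1 e2.
Qed.

(** [x * phi x] is again a test function; testing [u] against it and expanding its derivative gives
    the product rule. *)
Lemma weak_derivative_id_mul (u v : R -> R) : weak_derivative u v ->
  mu.-integrable (halfline R) (EFin \o (fun x => x * u x)) ->
  mu.-integrable (halfline R) (EFin \o (fun x => x * v x)) ->
  weak_derivative (fun x => x * u x) (fun x => u x + x * v x).
Proof.
move=> uv iu iv; have [lu lv _] := uv.
have oH : open (halfline R) by exact: interval_open.
have lxu := open_integrable_locally oH iu.
have lxv := open_integrable_locally oH iv.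
split => //; first exact: locally_integrableD lu lxv.
move=> phi tphi.
have tphi' := test_function_derive1 _ tphi.
rewrite !Rintegral_halfline; last 2 first.
- by move=> x x0; rewrite (test_function_le0 _ _ tphi)// mulr0.
- by move=> x x0; rewrite (test_function_le0 _ _ tphi')// mulr0.
have := weak_derivative_test _ _ _ uv (test_function_id_mul _ tphi).
have i1 := integrable_mul_test_function _ _ lxu tphi'.
have i2 := integrable_mul_test_function _ _ lu tphi.
have i3 := integrable_mul_test_function _ _ lxv tphi.
have -> : \int[mu]_x (u x * derive1 (fun x => x * phi x) x) =
    \int[mu]_x (x * u x * derive1 phi x + u x * phi x).
  apply: eq_Rintegral => x _; rewrite derive1_id_mul; first by ring.
  exact: test_function_smooth.
have -> : \int[mu]_x ((u x + x * v x) * phi x) = \int[mu]_x (u x * phi x + x * v x * phi x).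
  by apply: eq_Rintegral => x _; rewrite mulrDl.
have -> : \int[mu]_x (v x * (x * phi x)) = \int[mu]_x (x * v x * phi x).
  by apply: eq_Rintegral => x _; ring.
by rewrite !RintegralD// => e; lra.
Qed.

End id_mul_wderiv.

(** * The dissipation estimate for the primitive *)

Section dissipation.
Context {R : realType}.
Notation mu := (@lebesgue_measure R).
Notation L1 f := (mu.-integrable setT (EFin \o f)).
Variables (gamma : R) (g : R -> R).
Hypothesis gamma_ge2 : 2 <= gamma.
Hypothesis mg : measurable_fun setT g.
Hypothesis g_le0 : forall x : R, x <= 0 -> g x = 0.
Hypothesis ixg : L1 (fun x => x * g x).
Notation U := (primitive_infty g).
Hypothesis iU : L1 (fun x => x `^ (1 + gamma) * U x).
Hypothesis U0 : \int[mu]_x (x * U x) = 0.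

(** [x]^ s[is at most]1[on]]0, 1][and at most]x [^ (1 + gamma)] beyond, and [U] is integrable
    against both. *)
Lemma integrable_powR_primitive (s : R) : 0 <= s <= 1 + gamma -> L1 (fun x => x `^ s * U x).
Proof.
move=> /andP[s0 sg]; have iU1 := integrable_primitive_infty _ mg g_le0 ixg.
have := integrableD measurableT (integrable_norm iU1) (integrable_norm iU).
apply: le_integrable => //.
  apply/measurable_EFinP; apply: measurable_funM; first exact: measurable_powR.
  exact: measurable_primitive_infty.
move=> x _ /=; rewrite lee_fin -[leRHS]/`| `|U x| + `|x `^ (1 + gamma) * U x| |.
rewrite [leRHS]ger0_norm ?addr_ge0// !normrM !(ger0_norm (powR_ge0 _ _)).
have [x0|x0] := leP x 0; first by rewrite primitive_infty_le0// normr0 !mulr0 addr0.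
have [x1|x1] := leP x 1.
  rewrite -[leLHS]addr0 lerD ?mulr_ge0 ?powR_ge0// ler_piMl//.
  by rewrite -[leRHS]/((fun=> 1) s) -powR1 ge0_ler_powR// nnegrE ltW.
rewrite -[leLHS]add0r lerD// ler_wpM2r// ler_powR// ltW//.
Qed.

Let f x := x * U x.
Let h := cutoff (fun y => y `^ (gamma - 2)).

(** The integrand of the form with [U] in place of [u]. The gain kernel is factored as [y]^ (gamma -
    1) = y * y [^ (gamma - 2)], to exhibit the mean-zero [f] and the nondecreasing [h]. *)
Definition dissipation_integrand (x : R) : R := x * U x * (- (U x + x * g x) - U x
  + gamma * (2 * tail (fun y => f y * h y) x - x `^ gamma * U x)).

Lemma dissipation_estimate :
  [/\ L1 dissipation_integrand, L1 (fun x => x * U x ^+ 2) &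
      \int[mu]_x dissipation_integrand x <= - \int[mu]_x (x * U x ^+ 2)].
Proof.
have g2 := gamma_ge2.
have iU1 := integrable_primitive_infty _ mg g_le0 ixg.
have ixU : L1 f.
  have /integrable_powR_primitive : 0 <= (1 : R) <= 1 + gamma by apply/andP; split; lra.
  apply: eq_integrable => // x _ /=; congr (_%:E).
  have [x0|x0] := leP x 0; first by rewrite /f primitive_infty_le0// !mulr0.
  by rewrite powRr1// ltW.
have bound k : L1 k -> L1 (fun x => x * U x * k x).
  exact: integrable_id_mul_primitive_mul.
have ifh : L1 (fun x => f x * h x).
  have /integrable_powR_primitive : 0 <= gamma - 1 <= 1 + gamma by apply/andP; split; lra.
  apply: eq_integrable => // x _ /=; congr (_%:E).
  have [x0|x0] := leP x 0; first by rewrite /f primitive_infty_le0// !(mulr0, mul0r).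
  rewrite /f /h cutoff_gt0// (_ : gamma - 1 = (gamma - 2) + 1); last by ring.
  rewrite powRD; last by rewrite (gt_eqF x0) implybT.
  by rewrite (powRr1 (ltW x0)); ring.
have mh : measurable_fun setT h.
  apply: measurable_cutoff; apply: measurable_funTS; exact: measurable_powR.
have h0 x : 0 <= h x by rewrite /h /cutoff mulr_ge0// powR_ge0.
(* Monotonicity on the half-line is where [2 <= gamma] enters; the cut-off value [0] preserves it
   across the origin. *)
have homoh : {homo h : x y / x <= y}.
  move=> x y xy; have [x0|x0] := leP x 0; first by rewrite {1}/h cutoff_le0.
  have y0 := lt_le_trans x0 xy.
  have g0 : 0 <= gamma - 2 by lra.
  by rewrite /h !cutoff_gt0// ge0_ler_powR// nnegrE ltW.
have [iT T0] := integral_mul_tail_le0 f h ixU U0 mh h0 homoh ifh.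
set T := fun x => f x * tail (fun y => f y * h y) x in iT T0.
pose V x := x * U x * (U x + x * g x).
have iV : L1 V by apply: bound; exact: integrable_deriv_id_mul.
have V0 : \int[mu]_x V x = 0 by exact: integral_id_mul_primitive_deriv.
pose S x := x * U x * U x.
have iS : L1 S by exact: bound.
pose W x := x * U x * (x `^ gamma * U x).
have iW : L1 W.
  by apply: bound; apply: integrable_powR_primitive; apply/andP; split; lra.
have W0 : 0 <= \int[mu]_x W x.
  apply: Rintegral_ge0 => x _; have [x0|x0] := leP x 0.
    by rewrite /W primitive_infty_le0// !(mulr0, mul0r).
  rewrite (_ : W x = x * x `^ gamma * U x ^+ 2); last by rewrite /W; ring.
  by rewrite mulr_ge0 ?sqr_ge0// mulr_ge0 ?powR_ge0// ltW.
have eS : (fun x => x * U x ^+ 2) = S by apply/funext => x; rewrite /S; ring.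
(* [V] is the transport term, of integral zero; [T] is the gain, of nonpositive integral; [W] is the
   loss, nonnegative and subtracted. What remains is [- S], the claimed bound. *)
have e : dissipation_integrand =
    (fun x => (- 1 * V x - S x) + ((2 * gamma) * T x - gamma * W x)).
  by apply/funext => x; rewrite /dissipation_integrand /V /S /T /W /f; ring.
have iZ c k : L1 k -> L1 (fun x => c * k x) by move=> ik; exact: integrableZl ik.
have iB k1 k2 : L1 k1 -> L1 k2 -> L1 (fun x => k1 x - k2 x).
  by move=> i1 i2; exact: integrableB i1 i2.
have iD k1 k2 : L1 k1 -> L1 k2 -> L1 (fun x => k1 x + k2 x).
  by move=> i1 i2; exact: integrableD i1 i2.
rewrite eS e; split => //.
  by apply: iD; apply: iB => //; exact: iZ.
rewrite RintegralD//; [|by apply: iB => //; exact: iZ|by apply: iB; exact: iZ].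
rewrite !RintegralB//; try exact: iZ.
rewrite !RintegralZl// V0 mulr0 sub0r gerDl subr_le0.
apply: (@le_trans _ _ 0); last by rewrite mulr_ge0//; lra.
by rewrite mulr_ge0_le0//; lra.
Qed.

End dissipation.

(** * Transfer to the self-similar fragmentation operator *)

Section selfsim_fragmentation.
Context {R : realType}.
Notation mu := (@lebesgue_measure R).
Notation L1 f := (mu.-integrable setT (EFin \o f)).

(** For [0 < x] the gain integral only sees [y > x > 0], where [cutoff u] and [u] agree. *)
Lemma cutoff_selfsim_frag (gamma : R) (u : R -> R) :
  cutoff (fun x => x * u x * selfsim_frag gamma u x) =
  (fun x => x * cutoff u x * (- cutoff (wderiv (fun y => y * u y)) x - cutoff u x
    + gamma * (tail (fun y => 2 * y `^ (gamma - 1) * cutoff u y) x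
               - x `^ gamma * cutoff u x))).
Proof.
apply/funext => x; have [x0|x0] := leP x 0.
  by rewrite !cutoff_le0// mulr0 mul0r.
rewrite !cutoff_gt0// /selfsim_frag /frag /total_rate; congr (_ * (_ + _ * (_ - _))).
rewrite Rintegral_mkcond; apply: eq_Rintegral => y _.
rewrite patchE mem_setE in_itv/= andbT /frag_kernel; case: ltP => xy; last by rewrite mul0r.
by rewrite mul1r cutoff_gt0// (lt_trans x0).
Qed.

End selfsim_fragmentation.

(** Since a divergent integral is read as [0], integrability is part of the conclusion: it makes
    both sides of the inequality genuine integrals. *)
Theorem theorem3p1 (R : realType) (gamma : R) (hgamma : 2 <= gamma)
    (u : R -> R) (hu : Xi0 gamma u) :
  [/\ lebesgue_measure.-integrable (halfline R)
        (fun x => (x * u x * selfsim_frag gamma u x)%:E),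
      lebesgue_measure.-integrable (halfline R)
        (fun x => (x * u x ^+ 2)%:E),
      inner u (selfsim_frag gamma u) <=
        - Rintegral lebesgue_measure (halfline R) (fun x => x * u x ^+ 2) &
      - Rintegral lebesgue_measure (halfline R) (fun x => x * u x ^+ 2) =
        - normL2 u ^+ 2].
Proof.
case: hu => -[[_ ipu] [[mu ixu] [v uv [mv ixv]]]] u0.
have iu := (integrable_cutoff (fun x => x * u x)).1 ixu.
have iv := (integrable_cutoff (fun x => x * v x)).1 ixv.
pose g := cutoff v; pose U := primitive_infty g.
have mg : measurable_fun setT g by exact: measurable_cutoff.
have g_le0 (x : R) : x <= 0 -> g x = 0 by exact: cutoff_le0.
have U_le0 (x : R) : x <= 0 -> U x = 0 by exact: primitive_infty_le0.
have ixg : lebesgue_measure.-integrable setT (EFin \o (fun x => x * g x)).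
  by apply: eq_integrable iv => // x _ /=; rewrite /g /cutoff mulrCA.
have mU : measurable_fun setT U by exact: measurable_primitive_infty.
have muc := measurable_cutoff _ mu.
have uU : {ae lebesgue_measure, forall x, cutoff u x = U x}.
  have := weak_derivative_primitive u v uv iu iv; apply: ae_imply => x h.
  have [x0|x0] := leP x 0; first by rewrite cutoff_le0// U_le0.
  by rewrite cutoff_gt0// h.
pose w := wderiv (fun y => y * u y).
have wd : weak_derivative (fun y => y * u y) w.
  exact: weak_derivative_wderiv (weak_derivative_id_mul _ _ uv ixu ixv).
have mw : measurable_fun setT (cutoff w).
  by apply: measurable_cutoff; case: wd => _ [].
(* [wderiv] is a chosen representative, so it agrees with [u x + x * v x] only almost everywhere. *)
have wE := weak_derivative_unique _ _ _ wd (weak_derivative_id_mul _ _ uv ixu ixv).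
have ipU : lebesgue_measure.-integrable setT (EFin \o (fun x => x `^ (1 + gamma) * U x)).
  have := (integrable_cutoff (fun x => x `^ (1 + gamma) * u x)).1 ipu.
  apply: (ae_eq_integrable lebesgue_measure).
    by apply: measurable_funM => //; exact: measurable_powR.
  by apply: ae_imply uU => x <-; rewrite /cutoff mulrCA.
have U0 : \int[lebesgue_measure]_x (x * U x) = 0.
  rewrite -u0 [RHS]Rintegral_cutoff; apply: (ae_eq_Rintegral lebesgue_measure).
  - exact: measurable_funM.
  - exact: integrable_measurable iu.
  - by apply: ae_imply uU => x <-; rewrite /cutoff mulrCA.
have [iE iS E_le] := dissipation_estimate gamma g hgamma mg g_le0 ixg ipU U0.
pose q y := 2 * y `^ (gamma - 1) * cutoff u y.
have mq : measurable_fun setT q.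
  by apply: measurable_funM => //; apply: measurable_funM => //; exact: measurable_powR.
pose fh y := y * U y * cutoff (fun z => z `^ (gamma - 2)) y.
have mfh : measurable_fun setT fh.
  apply: measurable_funM; first exact: measurable_funM.
  by apply: measurable_cutoff; apply: measurable_funTS; exact: measurable_powR.
(* The two integrands agree almost everywhere in [y], so this equality of tails holds for every
   [x]. *)
have qE x : tail q x = 2 * tail fh x.
  rewrite -measurable_RintegralZl; last first.
    by apply: measurable_funM => //; exact: measurable_gt_indic.
  apply: (ae_eq_Rintegral lebesgue_measure).
  - by apply: measurable_funM => //; exact: measurable_gt_indic.
  - by apply: measurable_funM => //; apply: measurable_funM => //; exact: measurable_gt_indic.
  apply: ae_imply uU => y uy; rewrite /q /fh uy [RHS]mulrCA; congr (_ * _).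
  have [y0|y0] := leP y 0; first by rewrite U_le0// !(mulr0, mul0r).
  rewrite cutoff_gt0// (_ : gamma - 1 = (gamma - 2) + 1); last by ring.
  rewrite powRD; last by rewrite (gt_eqF y0) implybT.
  by rewrite (powRr1 (ltW y0)); ring.
(* Almost everywhere equality transfers integrability to measurable functions, so measurability is
   established for the operator applied to [u] itself. *)
have mQ : measurable_fun setT (cutoff (fun x => x * u x * selfsim_frag gamma u x)).
  rewrite cutoff_selfsim_frag.
  apply: measurable_funM; first exact: measurable_funM.
  apply: measurable_funD.
    by apply: measurable_funB => //; exact: measurableT_comp.
  apply: measurable_funM => //; apply: measurable_funB; first exact: measurable_tail.
  by apply: measurable_funM => //; exact: measurable_powR.
have QE : {ae lebesgue_measure, forall x, dissipation_integrand gamma g x =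
    cutoff (fun x => x * u x * selfsim_frag gamma u x) x}.
  rewrite cutoff_selfsim_frag; apply: ae_imply2 uU wE => x ux wx.
  rewrite /dissipation_integrand ux -/U qE -/fh.
  have [x0|x0] := leP x 0; first by rewrite U_le0// mulr0 !mul0r.
  by rewrite [cutoff (wderiv _) x]cutoff_gt0// -/w wx// -(cutoff_gt0 u x x0) ux -(cutoff_gt0 v x x0).
have SE : {ae lebesgue_measure, forall x, x * U x ^+ 2 = cutoff (fun x => x * u x ^+ 2) x}.
  apply: ae_imply uU => x ux; have [x0|x0] := leP x 0.
    by rewrite U_le0// cutoff_le0// expr0n mulr0.
  by rewrite cutoff_gt0// -ux cutoff_gt0.
have mS : measurable_fun setT (cutoff (fun x => x * u x ^+ 2)).
  rewrite (_ : cutoff _ = fun x => x * cutoff u x ^+ 2); last first.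
    apply/funext => x; have [x0|x0] := leP x 0; first by rewrite !cutoff_le0// expr0n mulr0.
    by rewrite !cutoff_gt0.
  by apply: measurable_funM => //; exact: measurable_funX.
split.
- by apply/integrable_cutoff; exact: (ae_eq_integrable lebesgue_measure _ _ mQ QE).
- by apply/integrable_cutoff; exact: (ae_eq_integrable lebesgue_measure _ _ mS SE).
- rewrite /inner !Rintegral_cutoff.
  rewrite -(ae_eq_Rintegral lebesgue_measure _ _ (integrable_measurable _ _ iE) mQ QE).
  by rewrite -(ae_eq_Rintegral lebesgue_measure _ _ (integrable_measurable _ _ iS) mS SE).
(* The integral is nonnegative, so squaring undoes the square root. *)
- rewrite /normL2 sqr_sqrtr//; apply: Rintegral_ge0 => x; rewrite halflineE => x0.
  by rewrite mulr_ge0 ?sqr_ge0// ltW.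
Qed.
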